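(* Let $\varphi$ be a formula of $\mathrm{SMT}_\mathrm{RL}$ over a single string variable $x$, and let $(\mathrm{TS},P) = \textrm{BFA-to-TS}(\textrm{SMT-to-BFA}(\varphi))$. Then for every word $w = \sigma_0\cdots\sigma_{n-1} \in \Sigma^*$, the assignment $x := w$ satisfies $\varphi$ if and only if $w$ is the input sequence of a counterexample to $P$ in $\mathrm{TS}$, i.e. there is a path $v_0,\sigma_0,v_1,\ldots,\sigma_{n-1},v_n$ of $\mathrm{TS}$ with $v_0$ satisfying $I_B$, $(v_k,\sigma_k,v_{k+1})$ satisfying $\Delta_B$ for all $0\le k<n$, and $v_n$ violating $P$. In particular, $\varphi$ is satisfiable iff $P$ is not valid in $\mathrm{TS}$.
   Context: Fix a finite alphabet $\Sigma$. $\mathrm{SMT}_\mathrm{RL}$ is the set of formulas generated by $\varphi ::= \varphi \wedge \varphi \mid \varphi \vee \varphi \mid \neg \varphi \mid x \in L$, where $x$ is a string variable and $L$ is the language of a regular expression over $\Sigma$; the semantics is Boolean logic together with language membership. A Boolean finite automaton (BFA) is a tuple $B = (\Sigma, \tilde Q, \tilde I, \tilde F, \tilde\Delta)$ where $\tilde Q$ is a finite set of state variables, $\tilde I$ is a Boolean formula over $\tilde Q$, $\tilde F : \tilde Q \to \{0,1\}$ is an assignment, and $\tilde\Delta$ assigns to each $q \in \tilde Q$ and $\sigma \in \Sigma$ a Boolean formula $\tilde\Delta(q,\sigma)$ over $\tilde Q$. A word $\sigma_0\cdots\sigma_{n-1}$ is accepted by $B$ iff the formula $G_n$ evaluates to true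 under the assignment $\tilde F$, where $G_0 = \tilde I$ and $G_{k+1}$ is obtained from $G_k$ by simultaneously replacing each $q \in \tilde Q$ by $\tilde\Delta(q,\sigma_k)$. NFA-to-BFA maps an NFA $(\Sigma, Q, I, F, \Delta)$ to the BFA with $\tilde Q = Q$, $\tilde I = \bigvee_{q\in I} q$, $\tilde F$ the indicator of $F$, and $\tilde\Delta(q,\sigma) = \bigvee\{q' : (q,\sigma,q')\in\Delta\}$. Re-to-NFA is the standard Thompson construction from a regular expression to an NFA with $\epsilon$-transitions, followed by $\epsilon$-elimination. BFA operations: for BFAs with disjoint state sets, $B_1 \cup B_2$ (resp. $B_1\cap B_2$) has state set $\tilde Q_1 \uplus \tilde Q_2$, final assignment and transition function the disjoint unions of those of $B_1,B_2$, and initial formula $\tilde I_1 \vee \tilde I_2$ (resp. $\tilde I_1 \wedge \tilde I_2$); $B^\complement$ is $B$ with initial formula $\neg\tilde I$. SMT-to-BFA rewrites $\varphi$ recursively into a single BFA: $x\in L \mapsto$ NFA-to-BFA(Re-to-NFA($L$)), $\wedge \mapsto \cap$, $\vee\mapsto\cup$, $\neg \mapsto {}^\complement$. A finite-state transition system consists of Boolean state bits, Boolean input bits encoding symbols of $\Sigma$, an initial-state formula $I_B$ over the state bits, and a transition formula $\Delta_B$ over current state bits, input symbol and next-state bits; a property $P$ is a formula over state bits, and $P$ is valid if no path from a state satisfying $I_B$ reaches a state violating $P$. BFA-to-TS maps a BFA $(\Sigma,\tilde Q,\tilde I,\tilde F,\tilde\Delta)$ to the transition system with one state bit $b_q$ per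 $q\in\tilde Q$, $I_B = \tilde I[q\mapsto b_q]$, transition relation $\bigwedge_{q\in\tilde Q} \big( b_q = \bigvee_{\sigma\in\Sigma} (x=\sigma \wedge \tilde\Delta(q,\sigma)[q'\mapsto b'_{q'}])\big)$ (where $b'$ are next-state bits and $x$ the current input symbol), and property $P = \bigvee_{\tilde F(q)=1}\neg b_q \vee \bigvee_{\tilde F(q)=0} b_q$ (so $P$ is violated exactly at the state equal to $\tilde F$). *)

(* Defs.v *)
From mathcomp Require Import all_boot.
Set Implicit Arguments. Unset Strict Implicit. Unset Printing Implicit Defensive.

Section Defs.
Variable Sigma : finType.

Inductive bform (X : Type) : Type :=
| BVar of X | BTrue | BFalse | BNeg of bform X
| BAnd of bform X & bform X | BOr of bform X & bform X.

Fixpoint beval (X : Type) (e : X -> bool) (f : bform X) : bool :=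
  match f with
  | BVar x => e x | BTrue => true | BFalse => false
  | BNeg g => ~~ beval e g
  | BAnd g h => beval e g && beval e h
  | BOr g h => beval e g || beval e h
  end.

Fixpoint bsubst (X Y : Type) (s : X -> bform Y) (f : bform X) : bform Y :=
  match f with
  | BVar x => s x | BTrue => BTrue Y | BFalse => BFalse Y
  | BNeg g => BNeg (bsubst s g)
  | BAnd g h => BAnd (bsubst s g) (bsubst s h)
  | BOr g h => BOr (bsubst s g) (bsubst s h)
  end.

Definition brename (X Y : Type) (r : X -> Y) (f : bform X) : bform Y :=
  bsubst (fun x => BVar (r x)) f.

Definition bigor (X : Type) (l : seq (bform X)) : bform X := foldr (@BOr X) (BFalse X) l.
Definition bigand (X : Type) (l : seq (bform X)) : bform X := foldr (@BAnd X) (BTrue X) l.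
Definition biff (X : Type) (a b : bform X) : bform X :=
  BOr (BAnd a b) (BAnd (BNeg a) (BNeg b)).

Inductive regex : Type :=
| REmpty | REps | RChr of Sigma | RCat of regex & regex
| RAlt of regex & regex | RStar of regex.

Fixpoint lang (r : regex) (w : seq Sigma) : Prop :=
  match r with
  | REmpty => False
  | REps => w = [::]
  | RChr a => w = [:: a]
  | RCat r1 r2 => exists w1 w2, w = w1 ++ w2 /\ lang r1 w1 /\ lang r2 w2
  | RAlt r1 r2 => lang r1 w \/ lang r2 w
  | RStar r1 => exists ws : seq (seq Sigma),
      w = flatten ws /\ (forall u, u \in ws -> lang r1 u)
  end.

(* formulas over the single string variable x; [SMem r] is  x \in L(r) *)
Inductive smt : Type :=
| SMem of regex | SAnd of smt & smt | SOr of smt & smt | SNot of smt.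

Fixpoint sat (phi : smt) (w : seq Sigma) : Prop :=
  match phi with
  | SMem r => lang r w
  | SAnd p q => sat p w /\ sat q w
  | SOr p q => sat p w \/ sat q w
  | SNot p => ~ sat p w
  end.

Record nfa : Type := NFA {
  nQ : finType;
  nI : pred nQ;
  nF : pred nQ;
  nD : nQ -> Sigma -> nQ -> bool }.

(* transition labels: None = epsilon, Some a = letter a.
   For base cases, state false = initial, true = final.
   For Alt / Star, inl false = new initial, inl true = new final. *)
Fixpoint tst (r : regex) : finType :=
  match r with
  | REmpty | REps | RChr _ => bool
  | RCat r1 r2 => (tst r1 + tst r2)%type
  | RAlt r1 r2 => (bool + (tst r1 + tst r2))%type
  | RStar r1 => (bool + tst r1)%type
  end.

Fixpoint tinit (r : regex) : tst r :=
  match r return tst r with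
  | REmpty | REps | RChr _ => false
  | RCat r1 r2 => inl (tinit r1)
  | RAlt r1 r2 => inl false
  | RStar r1 => inl false
  end.

Fixpoint tfin (r : regex) : tst r :=
  match r return tst r with
  | REmpty | REps | RChr _ => true
  | RCat r1 r2 => inr (tfin r2)
  | RAlt r1 r2 => inl true
  | RStar r1 => inl true
  end.

Unset Implicit Arguments.
Fixpoint tstep (r : regex) : tst r -> option Sigma -> tst r -> bool :=
  match r return tst r -> option Sigma -> tst r -> bool with
  | REmpty => fun _ _ _ => false
  | REps => fun p l q => [&& p == false, l == None & q == true]
  | RChr a => fun p l q => [&& p == false, l == Some a & q == true]
  | RCat r1 r2 => fun p l q =>
      match p, q with
      | inl p1, inl q1 => tstep r1 p1 l q1
      | inr p2, inr q2 => tstep r2 p2 l q2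
      | inl p1, inr q2 => [&& p1 == tfin r1, l == None & q2 == tinit r2]
      | inr _, inl _ => false
      end
  | RAlt r1 r2 => fun p l q =>
      match p, q with
      | inr (inl p1), inr (inl q1) => tstep r1 p1 l q1
      | inr (inr p2), inr (inr q2) => tstep r2 p2 l q2
      | inl false, inr (inl q1) => (l == None) && (q1 == tinit r1)
      | inl false, inr (inr q2) => (l == None) && (q2 == tinit r2)
      | inr (inl p1), inl true => (l == None) && (p1 == tfin r1)
      | inr (inr p2), inl true => (l == None) && (p2 == tfin r2)
      | _, _ => false
      end
  | RStar r1 => fun p l q =>
      match p, q with
      | inr p1, inr q1 =>
          tstep r1 p1 l q1 || [&& l == None, p1 == tfin r1 & q1 == tinit r1]
      | inl false, inr q1 => (l == None) && (q1 == tinit r1)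
      | inl false, inl true => l == None
      | inr p1, inl true => (l == None) && (p1 == tfin r1)
      | _, _ => false
      end
  end.

Definition teps (r : regex) : rel (tst r) := fun p q => tstep r p None q.

Definition re_to_nfa (r : regex) : nfa :=
  @NFA (tst r)
    (fun q => q == tinit r)
    (fun q => connect (teps r) q (tfin r))
    (fun q a q' => [exists p, connect (teps r) q p && tstep r p (Some a) q']).

Set Implicit Arguments.

Record bfa : Type := BFA {
  bQ : finType;
  bI : bform bQ;
  bF : bQ -> bool;
  bD : bQ -> Sigma -> bform bQ }.

Definition bfa_G (B : bfa) (w : seq Sigma) : bform (bQ B) :=
  foldl (fun G a => bsubst (fun q => bD q a) G) (bI B) w.

Definition bfa_accepts (B : bfa) (w : seq Sigma) : bool := beval (@bF B) (bfa_G B w).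

Definition nfa_to_bfa (A : nfa) : bfa :=
  @BFA (nQ A)
    (bigor [seq BVar q | q <- enum (nQ A) & nI q])
    (fun q => nF q)
    (fun q a => bigor [seq BVar q' | q' <- enum (nQ A) & nD q a q']).

Definition bfa_union (B1 B2 : bfa) : bfa :=
  @BFA (bQ B1 + bQ B2)%type
    (BOr (brename inl (bI B1)) (brename inr (bI B2)))
    (fun q => match q with inl q1 => bF q1 | inr q2 => bF q2 end)
    (fun q a => match q with
                | inl q1 => brename inl (bD q1 a)
                | inr q2 => brename inr (bD q2 a) end).

Definition bfa_inter (B1 B2 : bfa) : bfa :=
  @BFA (bQ B1 + bQ B2)%type
    (BAnd (brename inl (bI B1)) (brename inr (bI B2)))
    (fun q => match q with inl q1 => bF q1 | inr q2 => bF q2 end)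
    (fun q a => match q with
                | inl q1 => brename inl (bD q1 a)
                | inr q2 => brename inr (bD q2 a) end).

Definition bfa_compl (B : bfa) : bfa := @BFA (bQ B) (BNeg (bI B)) (@bF B) (@bD B).

Fixpoint smt_to_bfa (phi : smt) : bfa :=
  match phi with
  | SMem r => nfa_to_bfa (re_to_nfa r)
  | SAnd p q => bfa_inter (smt_to_bfa p) (smt_to_bfa q)
  | SOr p q => bfa_union (smt_to_bfa p) (smt_to_bfa q)
  | SNot p => bfa_compl (smt_to_bfa p)
  end.

(* variables of the transition formula: current state bit, next state bit,
   and the atom "x = a" on the current input symbol *)
Inductive tsvar (V : Type) : Type := Cur of V | Nxt of V | Inp of Sigma.

Record ts : Type := TS {
  tV : finType;
  tI : bform tV;
  tD : bform (tsvar tV);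
  tP : bform tV }.

Definition ts_step (T : ts) (v : tV T -> bool) (a : Sigma) (v' : tV T -> bool) : bool :=
  beval (fun x => match x with Cur q => v q | Nxt q => v' q | Inp b => b == a end) (tD T).

Fixpoint ts_path (T : ts) (v : tV T -> bool) (w : seq Sigma) (goal : (tV T -> bool) -> Prop)
  : Prop :=
  match w with
  | [::] => goal v
  | a :: w' => exists v', ts_step v a v' /\ ts_path v' w' goal
  end.

Definition ts_cex (T : ts) (w : seq Sigma) : Prop :=
  exists v0 : tV T -> bool, beval v0 (tI T) /\ ts_path v0 w (fun v => ~~ beval v (tP T)).

Definition ts_valid (T : ts) : Prop := ~ exists w, ts_cex T w.

Definition bfa_to_ts (B : bfa) : ts :=
  @TS (bQ B)
    (bI B)
    (bigand [seq biff (BVar (Cur q))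
                      (bigor [seq BAnd (BVar (Inp (bQ B) a)) (brename (@Nxt _) (bD q a))
                             | a <- enum Sigma])
            | q <- enum (bQ B)])
    (bigor ([seq BNeg (BVar q) | q <- enum (bQ B) & bF q]
            ++ [seq BVar q | q <- enum (bQ B) & ~~ bF q])).

End Defs.

(* Main.v *)
Require Import Defs.
From mathcomp Require Import all_boot.
From Stdlib Require Import Classical_Prop.
Set Implicit Arguments. Unset Strict Implicit. Unset Printing Implicit Defensive.

(* The BFA produced by SMT-to-BFA accepts exactly the words satisfying phi:
   union, intersection and complement only touch the initial formula, so they
   realise or, and, not, while for [x \in L] the BFA of an NFA accepts what the
   NFA accepts, and Thompson's construction followed by epsilon-elimination
   recognises L.  On the transition-system side, the transition formula fixes
   each current bit b_q to the value of Delta(q, a) at the next state, so a path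
   is determined backwards by its last state; the only state violating P is F,
   hence the only path reading w to a violation starts at the valuation
   sending q to the value under F of what q becomes after substituting along
   w, and that valuation satisfies I_B iff G_n is true under F. *)

Section BoolFormulas.
Variables X Y : Type.

Lemma eq_beval (e1 e2 : X -> bool) f : e1 =1 e2 -> beval e1 f = beval e2 f.
Proof. by move=> e12; elim: f => //= [g ->|g -> h ->|g -> h ->]. Qed.

Lemma beval_bsubst (e : Y -> bool) (s : X -> bform Y) f :
  beval e (bsubst s f) = beval (fun x => beval e (s x)) f.
Proof. by elim: f => //= [g ->|g -> h ->|g -> h ->]. Qed.

Lemma beval_brename (e : Y -> bool) (r : X -> Y) f :
  beval e (brename r f) = beval (e \o r) f.
Proof. exact: beval_bsubst. Qed.

Lemma beval_bigor (e : X -> bool) l : beval e (bigor l) = has (beval e) l.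
Proof. by elim: l => //= f l ->. Qed.

Lemma beval_bigand (e : X -> bool) l : beval e (bigand l) = all (beval e) l.
Proof. by elim: l => //= f l ->. Qed.

End BoolFormulas.

Lemma beval_bigor_BVar (T : finType) (e : T -> bool) (P : pred T) :
  beval e (bigor [seq BVar q | q <- enum T & P q]) = [exists q, P q && e q].
Proof.
rewrite beval_bigor has_map; apply/hasP/existsP => [[q]|[q /andP[Pq eq]]].
  by rewrite mem_filter => /andP[Pq _] /= eq; exists q; rewrite Pq.
by exists q => //; rewrite mem_filter Pq mem_enum.
Qed.

Lemma has_eq_andb_enum (T : finType) (a : T) (P : pred T) :
  has (fun b => (b == a) && P b) (enum T) = P a.
Proof.
apply/hasP/idP => [[b _ /andP[/eqP-> //]]|Pa].
by exists a; rewrite ?mem_enum ?eqxx.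
Qed.

Section Automata.
Variable Sigma : finType.
Implicit Types (w : seq Sigma) (B : bfa Sigma) (A : nfa Sigma).

(* The value under [F] of what [q] becomes after substituting along [w]:
   [bfa_G] substitutes from the front, [acc_from] evaluates from the back. *)
Fixpoint acc_from (Q : Type) (F : Q -> bool) (D : Q -> Sigma -> bform Q) w (q : Q) : bool :=
  if w is a :: w' then beval (acc_from F D w') (D q a) else F q.

Definition bfa_acc B : seq Sigma -> bQ B -> bool := acc_from (@bF _ B) (@bD _ B).
Arguments bfa_acc : clear implicits.

Lemma bfa_acceptsE B w : bfa_accepts B w = beval (bfa_acc B w) (bI B).
Proof.
rewrite /bfa_accepts /bfa_G; elim: w (bI B) => [|a w IH] f //=.
by rewrite IH beval_bsubst.
Qed.

Lemma acc_from_brename (Q1 Q2 : Type) (r : Q1 -> Q2) F1 D1 F2 D2 :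
    (forall q, F2 (r q) = F1 q) -> (forall q a, D2 (r q) a = brename r (D1 q a)) ->
  forall w q, acc_from F2 D2 w (r q) = acc_from F1 D1 w q.
Proof.
move=> F21 D21; elim=> [|a w IH] q /=; first exact: F21.
by rewrite D21 beval_brename; apply: eq_beval.
Qed.

Lemma bfa_accepts_union B1 B2 w :
  bfa_accepts (bfa_union B1 B2) w = bfa_accepts B1 w || bfa_accepts B2 w.
Proof.
rewrite !bfa_acceptsE /= !beval_brename.
by congr orb; apply: eq_beval => q; apply: acc_from_brename.
Qed.

Lemma bfa_accepts_inter B1 B2 w :
  bfa_accepts (bfa_inter B1 B2) w = bfa_accepts B1 w && bfa_accepts B2 w.
Proof.
rewrite !bfa_acceptsE /= !beval_brename.
by congr andb; apply: eq_beval => q; apply: acc_from_brename.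
Qed.

Lemma bfa_accepts_compl B w : bfa_accepts (bfa_compl B) w = ~~ bfa_accepts B w.
Proof. by rewrite !bfa_acceptsE. Qed.

Fixpoint nfa_acc A w (q : nQ A) : bool :=
  if w is a :: w' then [exists q', nD q a q' && nfa_acc w' q'] else nF q.
Arguments nfa_acc : clear implicits.

Lemma bfa_acc_nfa_to_bfa A w : bfa_acc (nfa_to_bfa A) w =1 nfa_acc A w.
Proof.
elim: w => [|a w IH] q //=; rewrite /bfa_acc /= beval_bigor_BVar.
by apply: eq_existsb => q'; rewrite -IH.
Qed.

Lemma bfa_accepts_nfa_to_bfa A w :
  bfa_accepts (nfa_to_bfa A) w = [exists q, nI q && nfa_acc A w q].
Proof.
rewrite bfa_acceptsE /= beval_bigor_BVar.
by apply: eq_existsb => q; rewrite bfa_acc_nfa_to_bfa.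
Qed.

Section BfaToTs.
Variable B : bfa Sigma.
Let T := bfa_to_ts B.
Let violates (v : tV T -> bool) := ~~ beval v (tP T).
Implicit Types v : bQ B -> bool.

Lemma bfa_to_ts_stepE v a (v' : bQ B -> bool) :
  @ts_step _ T v a v' = [forall q, v q == beval v' (bD q a)].
Proof.
rewrite /ts_step /= beval_bigand all_map.
apply/allP/forallP => [vD q | vD q _] /=.
  move: (vD q (mem_enum _ q)) => /=; rewrite beval_bigor has_map /=.
  under eq_has => b do rewrite /= beval_brename.
  by rewrite has_eq_andb_enum; case: (v q); case: (beval _ _).
rewrite beval_bigor has_map /=.
under eq_has => b do rewrite /= beval_brename.
by rewrite has_eq_andb_enum (eqP (vD q)); case: (beval _ _).
Qed.

Lemma bfa_to_ts_violatesE v : violates v = [forall q, v q == bF q].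
Proof.
rewrite /violates /= beval_bigor has_cat !has_map negb_or.
apply/andP/forallP => [[/hasPn F1 /hasPn F0] q|vF].
  case Fq: (bF q).
    by have := F1 q; rewrite mem_filter Fq mem_enum /= => /(_ isT); case: (v q).
  by have := F0 q; rewrite mem_filter Fq mem_enum /= => /(_ isT); case: (v q).
by split; apply/hasPn => q; rewrite mem_filter => /andP[Fq _] /=;
  move: (vF q) Fq; case: (bF q); case: (v q).
Qed.

(* The transition relation determines the current state from the next one,
   so the only state from which [w] leads to a violation is [bfa_acc B w]. *)
Lemma bfa_to_ts_pathE w v : @ts_path _ T v w violates <-> v =1 bfa_acc B w.
Proof.
elim: w v => [|a w IH] v /=.
  rewrite bfa_to_ts_violatesE; split => [/forallP vF q|vF]; first exact/eqP.
  by apply/forallP => q; rewrite vF.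
split => [[v' [st /IH v'E]] q | vE].
  by move: st; rewrite bfa_to_ts_stepE => /forallP /(_ q) /eqP ->; apply: eq_beval.
exists (bfa_acc B w); split; last exact/IH.
by rewrite bfa_to_ts_stepE; apply/forallP => q; rewrite vE.
Qed.

Lemma bfa_to_ts_cexE w : ts_cex T w <-> bfa_accepts B w.
Proof.
rewrite bfa_acceptsE; split => [[v0 [I0 /bfa_to_ts_pathE v0E]]|acc].
  by rewrite -(eq_beval _ v0E).
by exists (bfa_acc B w); split => //; apply/bfa_to_ts_pathE.
Qed.

End BfaToTs.
End Automata.
Arguments bfa_acc {Sigma} B.
Arguments nfa_acc {Sigma} A w q.

Section Runs.
Variable Sigma : finType.

Inductive run (T : Type) (st : T -> option Sigma -> T -> bool) : T -> seq Sigma -> T -> Prop :=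
| run_nil p : run st p [::] p
| run_eps p p' w q : st p None p' -> run st p' w q -> run st p w q
| run_sym p a p' w q : st p (Some a) p' -> run st p' w q -> run st p (a :: w) q.

Section RunLemmas.
Variables (T : Type) (st : T -> option Sigma -> T -> bool).

Lemma run_cat p w1 q w2 s : run st p w1 q -> run st q w2 s -> run st p (w1 ++ w2) s.
Proof.
elim=> // [x x' w y h _ IH|x a x' w y h _ IH] R; first exact: run_eps h (IH R).
exact: run_sym h (IH R).
Qed.

Lemma run_stuck p w q :
  (forall l p', st p l p' = false) -> run st p w q -> q = p /\ w = [::].
Proof. by move=> + R; case: R => // [x x' w' y|x a x' w' y] h _ stuck; rewrite stuck in h. Qed.

Lemma run_inv p w q : run st p w q ->
  [\/ q = p /\ w = [::], exists2 p', st p None p' & run st p' w q |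
      exists a w' p', [/\ w = a :: w', st p (Some a) p' & run st p' w' q]].
Proof.
case=> [x|x x' w' y h R|x a x' w' y h R]; first by constructor 1.
  by constructor 2; exists x'.
by constructor 3; exists a, w', x'.
Qed.

End RunLemmas.

Lemma run_map (T U : Type) (st1 : T -> option Sigma -> T -> bool)
    (st2 : U -> option Sigma -> U -> bool) (f : T -> U) :
    (forall x l y, st1 x l y -> st2 (f x) l (f y)) ->
  forall x w y, run st1 x w y -> run st2 (f x) w (f y).
Proof.
move=> st12 x w y; elim=> [p|p p' w' q h _ IH|p a p' w' q h _ IH].
- exact: run_nil.
- exact: run_eps (st12 _ _ _ h) IH.
- exact: run_sym (st12 _ _ _ h) IH.
Qed.

Section FiniteRuns.
Variables (T : finType) (st : T -> option Sigma -> T -> bool).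
Let eps : rel T := fun x y => st x None y.

Lemma run_nilE p q : run st p [::] q <-> connect eps p q.
Proof.
split.
  move=> R; move w0E: [::] R => w0 R.
  elim: R w0E => [x _|x x' w' y h _ IH w'E|//]; first exact: connect0.
  exact: connect_trans (connect1 h) (IH w'E).
case/connectP => s; elim: s p => [p _ ->|x s IH p /= /andP[h pth] qE].
  exact: run_nil.
exact: run_eps h (IH _ pth qE).
Qed.

Lemma run_consE p a w q :
  run st p (a :: w) q <->
  exists m p', [/\ connect eps p m, st m (Some a) p' & run st p' w q].
Proof.
split=> [|[m [p' [/run_nilE pm h R]]]]; last exact: run_cat pm (run_sym h R).
move=> R; move w0E: (a :: w) R => w0 R.
elim: R a w w0E => // [x x' w' y h _ IH|x b x' w' y h R _] a w w0E.
  have [m [p' [xm mp' R']]] := IH _ _ w0E.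
  by exists m, p'; split => //; exact: connect_trans (connect1 h) xm.
by case: w0E => -> ->; exists x, x'; rewrite connect0.
Qed.

End FiniteRuns.

Lemma re_to_nfa_accE (r : regex Sigma) w p :
  nfa_acc (re_to_nfa _ r) w p <-> run (tstep _ r) p w (tfin r).
Proof.
elim: w p => [|a w IH] p /=; first by rewrite run_nilE.
rewrite run_consE; split.
  case/existsP => p' /andP[/existsP[m /andP[pm h]] /IH R].
  by exists m, p'.
case=> m [p' [pm h /IH R]].
by apply/existsP; exists p'; rewrite R andbT; apply/existsP; exists m; rewrite pm.
Qed.

End Runs.

Section Thompson.
Variable Sigma : finType.
Implicit Types (r : regex Sigma) (w : seq Sigma).

Lemma run_RStar_inr r1 x u y :
  run (tstep _ r1) x u y -> run (tstep _ (RStar r1)) (inr x) u (inr y).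
Proof. by apply: run_map => x' l y' /= ->. Qed.

Lemma run_RStar_iter r1 :
    (forall u, lang r1 u -> run (tstep _ r1) (tinit r1) u (tfin r1)) ->
  forall us, (forall u, u \in us -> lang r1 u) ->
  run (tstep _ (RStar r1)) (inr (tfin r1)) (flatten us) (inr (tfin r1)).
Proof.
move=> IH1; elim=> [|u us IHus] Lus; first exact: run_nil.
have Ru := run_RStar_inr (IH1 _ (Lus _ (mem_head _ _))).
apply: run_eps (run_cat Ru (IHus (fun v vin => Lus v (@mem_behead _ (u :: us) _ vin)))).
by rewrite /= !eqxx orbT.
Qed.

Lemma thompson_complete r w : lang r w -> run (tstep _ r) (tinit r) w (tfin r).
Proof.
elim: r w => [| |a|r1 IH1 r2 IH2|r1 IH1 r2 IH2|r1 IH1] w //.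
- by move=> /= ->; apply: run_eps (run_nil _ _); rewrite /= !eqxx.
- by move=> /= ->; apply: run_sym (run_nil _ _); rewrite /= !eqxx.
- case=> w1 [w2 [-> [L1 L2]]].
  apply: run_cat (run_map (f := inl) _ (IH1 _ L1)) _ => //.
  by apply: run_eps (run_map (f := inr) _ (IH2 _ L2)) => //=; rewrite !eqxx.
- case=> L.
    rewrite -[w]cats0; apply: run_eps; last first.
      apply: run_cat (run_map (f := fun x => inr (inl x)) _ (IH1 _ L)) _ => //.
      by apply: run_eps (run_nil _ _); rewrite /= !eqxx.
    by rewrite /= !eqxx.
  rewrite -[w]cats0; apply: run_eps; last first.
    apply: run_cat (run_map (f := fun x => inr (inr x)) _ (IH2 _ L)) _ => //.
    by apply: run_eps (run_nil _ _); rewrite /= !eqxx.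
  by rewrite /= !eqxx.
- case=> -[|u us] [-> Lus]; first exact: run_eps (run_nil _ _).
  have Ru := run_RStar_inr (IH1 _ (Lus _ (mem_head _ _))).
  have Rus := run_RStar_iter IH1 (fun v vin => Lus v (@mem_behead _ (u :: us) _ vin)).
  have Rexit : run (tstep _ (RStar r1)) (inr (tfin r1)) [::] (inl true).
    by apply: run_eps (run_nil _ _); rewrite /= !eqxx.
  rewrite /= -[_ ++ flatten us]cats0 -catA.
  by apply: run_eps (run_cat Ru (run_cat Rus Rexit)); rewrite /= !eqxx.
Qed.

Lemma run_RCat_inr r1 r2 p w q :
  run (tstep _ (RCat r1 r2)) (inr p) w (inr q) -> run (tstep _ r2) p w q.
Proof.
move=> R; move Ex: (inr p) R => x; move Ey: (inr q) => y R.
elim: R p Ex Ey => [x0|x0 x' w' y0 h _ IH|x0 a x' w' y0 h _ IH] p Ex Ey; subst.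
- by case: Ey => ->; exact: run_nil.
- by case: x' h IH => x' //= h IH; exact: run_eps h (IH _ erefl erefl).
- by case: x' h IH => x' //= h IH; exact: run_sym h (IH _ erefl erefl).
Qed.

Lemma run_RCat_split r1 r2 p w q :
  run (tstep _ (RCat r1 r2)) (inl p) w (inr q) ->
  exists w1 w2, [/\ w = w1 ++ w2, run (tstep _ r1) p w1 (tfin r1)
                   & run (tstep _ r2) (tinit r2) w2 q].
Proof.
move=> R; move Ex: (inl p) R => x; move Ey: (inr q) => y R.
elim: R p Ex Ey => [x0|x0 x' w' y0 h R IH|x0 a x' w' y0 h R IH] p Ex Ey; subst => //.
- case: x' h R IH => x' /= h R IH.
    have [w1 [w2 [-> R1 R2]]] := IH _ erefl erefl.
    by exists w1, w2; split => //; exact: run_eps h R1.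
  case/andP: h => /eqP -> /eqP x'E; subst x'.
  by exists [::], w'; split => //; [exact: run_nil | exact: run_RCat_inr R].
- case: x' h R IH => x' /= h R IH; last by rewrite andbF in h.
  have [w1 [w2 [-> R1 R2]]] := IH _ erefl erefl.
  by exists (a :: w1), w2; split => //; exact: run_sym h R1.
Qed.

Lemma run_RAlt_inl r1 r2 p w :
  run (tstep _ (RAlt r1 r2)) (inr (inl p)) w (inl true) -> run (tstep _ r1) p w (tfin r1).
Proof.
move=> R; move Ex: (inr (inl p)) R => x; move Ey: (inl true) => y R.
elim: R p Ex Ey => [x0|x0 x' w' y0 h R IH|x0 a x' w' y0 h R IH] p Ex Ey; subst => //.
- case: x' h R IH => [[]|[x'|x']] //= h R IH; last exact: run_eps h (IH _ erefl erefl).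
  move/eqP: h => ->; have [_ ->] := run_stuck (p := inl true) (fun l z => erefl) R.
  exact: run_nil.
- by case: x' h R IH => [[]|[x'|x']] //= h R IH; exact: run_sym h (IH _ erefl erefl).
Qed.

Lemma run_RAlt_inr r1 r2 p w :
  run (tstep _ (RAlt r1 r2)) (inr (inr p)) w (inl true) -> run (tstep _ r2) p w (tfin r2).
Proof.
move=> R; move Ex: (inr (inr p)) R => x; move Ey: (inl true) => y R.
elim: R p Ex Ey => [x0|x0 x' w' y0 h R IH|x0 a x' w' y0 h R IH] p Ex Ey; subst => //.
- case: x' h R IH => [[]|[x'|x']] //= h R IH; last exact: run_eps h (IH _ erefl erefl).
  move/eqP: h => ->; have [_ ->] := run_stuck (p := inl true) (fun l z => erefl) R.
  exact: run_nil.
- by case: x' h R IH => [[]|[x'|x']] //= h R IH; exact: run_sym h (IH _ erefl erefl).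
Qed.

Lemma tstep_RStar_final r1 l (x : tst (RStar r1)) : tstep _ (RStar r1) (inl true) l x = false.
Proof. by case: x => [[]|]. Qed.

Lemma run_RStar_split r1 :
    (forall u, run (tstep _ r1) (tinit r1) u (tfin r1) -> lang r1 u) ->
  forall p w, run (tstep _ (RStar r1)) (inr p) w (inl true) ->
  exists w0 us, [/\ w = w0 ++ flatten us, run (tstep _ r1) p w0 (tfin r1)
                  & forall u, u \in us -> lang r1 u].
Proof.
move=> IH1 p w R; move Ex: (inr p) R => x; move Ey: (inl true) => y R.
elim: R p Ex Ey => [x0|x0 x' w' y0 h R IH|x0 a x' w' y0 h R IH] p Ex Ey; subst => //.
- case: x' h R IH => [[]|x'] //= h R IH.
    move/eqP: h => ->; have [_ ->] := run_stuck (@tstep_RStar_final r1) R.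
    by exists [::], [::]; split => //; exact: run_nil.
  have [w0 [us [-> R0 Lus]]] := IH _ erefl erefl.
  case/orP: h => [h|/andP[/eqP -> /eqP x'E]].
    by exists w0, us; split => //; exact: run_eps h R0.
  subst x'; exists [::], (w0 :: us); split => //; first exact: run_nil.
  by move=> u; rewrite inE => /orP[/eqP ->|]; [exact: IH1 | exact: Lus].
- case: x' h R IH => [[]|x'] //= h R IH.
  have [w0 [us [-> R0 Lus]]] := IH _ erefl erefl.
  rewrite orbF in h.
  by exists (a :: w0), us; split => //; exact: run_sym h R0.
Qed.

Lemma thompson_sound r w : run (tstep _ r) (tinit r) w (tfin r) -> lang r w.
Proof.
elim: r w => [| |c|r1 IH1 r2 IH2|r1 IH1 r2 IH2|r1 IH1] w R /=.
- by have [] := run_stuck (fun l z => erefl) R.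
- case: (run_inv R) => [[//]|[p' h R']|[b [w' [p' [_ h _]]]]] //.
  move: h => /= /eqP p'E; subst p'.
  by have [_ ->] := run_stuck (p := true) (fun l z => erefl) R'.
- case: (run_inv R) => [[//]|[p' h R']|[b [w' [p' [-> h R']]]]] //.
  case/and3P: h => _ /eqP[->] /eqP p'E; subst p'.
  by have [_ ->] := run_stuck (p := true) (fun l z => erefl) R'.
- have [w1 [w2 [-> R1 R2]]] := run_RCat_split R.
  by exists w1, w2; split => //; split; [exact: IH1 | exact: IH2].
- case: (run_inv R) => [[//]|[p' h R']|[b [w' [p' [_ h _]]]]]; last by case: p' h => [[]|[]].
  case: p' h R' => [[]|[p'|p']] //= /eqP p'E R'; subst p'.
    by left; apply: IH1; exact: run_RAlt_inl R'.
  by right; apply: IH2; exact: run_RAlt_inr R'.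
- case: (run_inv R) => [[//]|[p' h R']|[b [w' [p' [_ h _]]]]]; last by case: p' h => [[]|].
  case: p' h R' => [[]|p'] //= h R'.
    by have [_ ->] := run_stuck (@tstep_RStar_final r1) R'; exists [::].
  move/eqP: h => p'E; subst p'.
  have [w0 [us [-> R0 Lus]]] := run_RStar_split IH1 R'.
  exists (w0 :: us); split => // u; rewrite inE => /orP[/eqP ->|]; [exact: IH1 | exact: Lus].
Qed.

Lemma thompson_correct r w : run (tstep _ r) (tinit r) w (tfin r) <-> lang r w.
Proof. by split; [exact: thompson_sound | exact: thompson_complete]. Qed.

End Thompson.

Lemma bfa_accepts_re_to_nfa (Sigma : finType) (r : regex Sigma) w :
  bfa_accepts (nfa_to_bfa (re_to_nfa _ r)) w <-> lang r w.
Proof.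
rewrite bfa_accepts_nfa_to_bfa -thompson_correct.
split=> [/existsP[q /andP[/eqP -> /re_to_nfa_accE //]]|R].
by apply/existsP; exists (tinit r); rewrite /= eqxx; apply/re_to_nfa_accE.
Qed.

Lemma smt_to_bfa_correct (Sigma : finType) (phi : smt Sigma) w :
  bfa_accepts (smt_to_bfa phi) w <-> sat phi w.
Proof.
elim: phi => [r|p IHp q IHq|p IHp q IHq|p IHp] /=.
- exact: bfa_accepts_re_to_nfa.
- by rewrite bfa_accepts_inter -IHp -IHq; split => /andP.
- by rewrite bfa_accepts_union -IHp -IHq; split => /orP.
- by rewrite bfa_accepts_compl -IHp; split => /negP.
Qed.

Theorem mainTheorem2 (Sigma : finType) (phi : smt Sigma) :
  (forall w : seq Sigma, sat phi w <-> ts_cex (bfa_to_ts (smt_to_bfa phi)) w) /\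
  ((exists w : seq Sigma, sat phi w) <-> ~ ts_valid (bfa_to_ts (smt_to_bfa phi))).
Proof.
have cexE w : sat phi w <-> ts_cex (bfa_to_ts (smt_to_bfa phi)) w.
  by rewrite bfa_to_ts_cexE smt_to_bfa_correct.
split=> //; split=> [[w /cexE cex] valid|not_valid]; first by apply: valid; exists w.
apply: NNPP => no_sat; apply: not_valid => -[w /cexE sat_w].
by apply: no_sat; exists w.
Qed.
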